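(* Let $r=\nu\delta^{\tau}$ and $r'=\nu'\delta^{\tau'}$ be monomials, with $\nu,\nu',\tau,\tau'\in\overline{\mathbb Z}$. Then $$r\odot r'=(\nu+\nu')\,\delta^{\min(\tau,\tau')},$$ with the convention that $+\infty-\infty=+\infty$ (i.e. $(+\infty)+(-\infty)=+\infty$).
   Context: Let $\overline{\mathbb Z}=\mathbb Z\cup\{-\infty,+\infty\}$ with its standard order. A counter is a map $s:\overline{\mathbb Z}\to\overline{\mathbb Z}$ that is non-decreasing for the standard order and satisfies $s(-\infty)=-\infty$, $s(+\infty)=+\infty$; $\Sigma$ is the set of counters. Thus a counter is determined by its values on $\mathbb Z$. The Hadamard product of $s_1,s_2\in\Sigma$ is the counter $s_1\odot s_2$ with $(s_1\odot s_2)(t)=s_1(t)+s_2(t)$ for all $t\in\mathbb Z$, where $(+\infty)+(-\infty)=+\infty$. For $n,t_0\in\overline{\mathbb Z}$, the monomial $n\delta^{t_0}$ denotes the counter with value $n$ at every $t\in\mathbb Z$ with $t\le t_0$, and value $+\infty$ at every $t\in\mathbb Z$ with $t>t_0$. *)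

(* Defs.v *)
From mathcomp Require Import all_boot all_order all_algebra.
From mathcomp Require Import constructive_ereal.

Set Implicit Arguments.
Unset Strict Implicit.
Unset Printing Implicit Defensive.

Import Order.TTheory GRing.Theory Num.Theory.
Import DualAddTheory.

Local Open Scope ring_scope.
Local Open Scope ereal_scope.

Record counter := Counter {
  counter_fun :> \bar int -> \bar int;
  counter_homo : {homo counter_fun : x y / x <= y};
  counterNy : counter_fun -oo = -oo;
  countery : counter_fun +oo = +oo
}.

Section CounterOf.
Variable f : int -> \bar int.

Definition extend_int (t : \bar int) : \bar int :=
  match t with
  | t'%:E => f t'
  | +oo => +oo
  | -oo => -oo
  end.

Hypothesis f_homo : {homo f : x y / (x <= y)%R >-> x <= y}.

Lemma extend_int_homo : {homo extend_int : x y / x <= y}.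
Proof.
by case=> [x||] [y||] //=; rewrite ?leey ?leNye // lee_fin; apply: f_homo.
Qed.

Definition counter_of : counter :=
  Counter extend_int_homo (erefl (-oo)) (erefl +oo).

End CounterOf.

Lemma hadamard_homo (s1 s2 : counter) :
  {homo (fun t : int => (s1 t%:E + s2 t%:E)%dE) : x y / (x <= y)%R >-> x <= y}.
Proof. by move=> x y xy; apply: lee_dD; apply: counter_homo; rewrite lee_fin. Qed.

(* The addition of scope %dE satisfies (+oo) + (-oo) = +oo, whereas that of
   scope %E satisfies (+oo) + (-oo) = -oo. *)
Definition hadamard (s1 s2 : counter) : counter :=
  counter_of (hadamard_homo s1 s2).

Lemma monomial_homo (n t0 : \bar int) :
  {homo (fun t : int => if t%:E <= t0 then n else +oo) :
    x y / (x <= y)%R >-> x <= y}.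
Proof.
move=> x y xy; case: (boolP (y%:E <= t0)) => [yt|_]; last exact: leey.
by rewrite (le_trans _ yt) // lee_fin.
Qed.

Definition monomial (n t0 : \bar int) : counter :=
  counter_of (monomial_homo n t0).

(* Main.v *)
Require Import Defs.
From mathcomp Require Import all_boot all_order all_algebra.
From mathcomp Require Import constructive_ereal.
From mathcomp Require Import boolp.
Import DualAddTheory.

(** Values at [-oo] and [+oo] are prescribed, so it suffices to compare counters at finite [t].
    There [t] is below the minimum iff it is below both bounds; if either bound fails, one summand
    is [+oo], which absorbs everything under [%dE]. *)

Lemma counter_ext (s1 s2 : counter) :
  (forall t : int, s1 t%:E = s2 t%:E) -> s1 = s2.
Proof.
case: s1 s2 => [f1 h1 n1 p1] [f2 h2 n2 p2] /= f12.
have ef : f1 = f2 by apply/funext => -[t||]; rewrite ?f12 ?n1 ?n2 ?p1 ?p2.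
move: h1 n1 p1 h2 n2 p2; rewrite ef => h1 n1 p1 h2 n2 p2.
by congr Counter; exact: Prop_irrelevance.
Qed.

Theorem proposition3p1 (nu nu' tau tau' : \bar int) :
  hadamard (monomial nu tau) (monomial nu' tau') =
  monomial (nu + nu')%dE (Order.min tau tau').
Proof.
apply: counter_ext => t /=; rewrite Order.TotalTheory.le_min.
case: (_ <= tau)%O; case: (_ <= tau')%O => //=.
(* Only [tau' < t <= tau] does not compute: [nu + +oo = +oo], which for [nu = -oo] is the chosen
   convention. *)
exact: daddey.
Qed.
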